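(* As formal power series in $z$ with coefficients in $\mathbb{Z}[y,\lambda]$, \[ \sum_{n\geq 0}\sum_{\sigma\in \mathfrak{S}_n}y^{\mathsf{des}_2(\sigma)}\lambda^{\mathsf{cyc}(\sigma)}z^{n}=\cfrac{1}{1-a_0z-\cfrac{b_1 z^2}{1-a_1z-\cfrac{b_2 z^2}{1-a_2z-\cfrac{b_3 z^2}{1-a_3z-\cdots}}}} \] where $a_n=\lambda+2n$ for $n\ge 0$ and $b_n=(\lambda+n-1)(y+n-1)$ for $n\ge 1$.
   Context: $\mathfrak{S}_n$ is the set of permutations of $[n]=\{1,\dots,n\}$ ($\mathfrak{S}_0$ consists of the empty permutation, contributing $1$). For $\pi\in\mathfrak{S}_n$: an index $i$ with $1\le i<n$ is a descent if $\pi(i)>\pi(i+1)$; an index $i$ is a record if $\pi(j)<\pi(i)$ for all $j<i$ (so $i=1$ is always a record); an index is a descent of type $2$ if it is both a descent and a record. $\mathsf{des}_2(\pi)$ is the number of descents of type $2$ of $\pi$, and $\mathsf{cyc}(\pi)$ is the number of cycles of $\pi$ (fixed points included). The infinite continued fraction is understood as a formal power series in $z$ (the $z$-adic limit of its finite truncations). *)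

(* Defs.v *)
From HB Require Import structures.
From mathcomp Require Import all_boot all_algebra all_fingroup.
From mathcomp Require Import boolp mpoly.

Set Implicit Arguments.
Unset Strict Implicit.
Unset Printing Implicit Defensive.

Import GRing.Theory.
Local Open Scope ring_scope.

(* The series \sum_n (fps_coef f n) z^n.  Being wrapped in a record, it gets   *)
(* the Cauchy product rather than a pointwise one.                             *)
Record fps (R : Type) := Fps { fps_coef : nat -> R }.

HB.instance Definition _ (R : Type) := gen_eqMixin (fps R).
HB.instance Definition _ (R : Type) := gen_choiceMixin (fps R).

Lemma fpsP (R : Type) (f g : fps R) :
  (forall n, fps_coef f n = fps_coef g n) -> f = g.
Proof. by case: f g => [f] [g] /= fg; congr Fps; apply/funext. Qed.

Section FpsRing.
Variable R : comUnitRingType.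
Implicit Types f g h : fps R.

Definition fps_zero : fps R := Fps (fun=> 0).
Definition fps_opp f : fps R := Fps (fun n => - fps_coef f n).
Definition fps_add f g : fps R := Fps (fun n => fps_coef f n + fps_coef g n).

Lemma fps_addA : associative fps_add.
Proof. by move=> f g h; apply: fpsP => n /=; rewrite addrA. Qed.
Lemma fps_addC : commutative fps_add.
Proof. by move=> f g; apply: fpsP => n /=; rewrite addrC. Qed.
Lemma fps_add0 : left_id fps_zero fps_add.
Proof. by move=> f; apply: fpsP => n /=; rewrite add0r. Qed.
Lemma fps_addN : left_inverse fps_zero fps_opp fps_add.
Proof. by move=> f; apply: fpsP => n /=; rewrite addNr. Qed.

HB.instance Definition _ :=
  Algebra.isZmodule.Build (fps R) fps_addA fps_addC fps_add0 fps_addN.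

Definition fpsC (c : R) : fps R := Fps (fun n => if n == 0%N then c else 0).
Definition fps_mul f g : fps R :=
  Fps (fun n => \sum_(i < n.+1) fps_coef f i * fps_coef g (n - i)%N).

Definition fps_trunc n f : {poly R} := \poly_(i < n) fps_coef f i.

Lemma fps_mul_trunc n f g k : (k < n)%N ->
  fps_coef (fps_mul f g) k = (fps_trunc n f * fps_trunc n g)`_k.
Proof.
move=> ltkn; rewrite coefM; apply: eq_bigr => i _.
have leik : (i <= k)%N by rewrite -ltnS.
by rewrite !coef_poly !(leq_ltn_trans _ ltkn) ?leq_subr.
Qed.

Lemma fps_mulC : commutative fps_mul.
Proof.
by move=> f g; apply: fpsP => n; rewrite !(@fps_mul_trunc n.+1) // mulrC.
Qed.

Lemma fps_mulA : associative fps_mul.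
Proof.
move=> f g h; apply: fpsP => n.
have E1 (u v : fps R) : fps_coef (fps_mul u (fps_mul v h)) n =
    (fps_trunc n.+1 u * (fps_trunc n.+1 v * fps_trunc n.+1 h))`_n.
  rewrite coefM; apply: eq_bigr => i _.
  by rewrite coef_poly ltn_ord (@fps_mul_trunc n.+1) // ltnS leq_subr.
rewrite E1 mulrA coefM; apply: eq_bigr => i _.
by rewrite (@fps_mul_trunc n.+1) // coef_poly ltnS leq_subr.
Qed.

Lemma fps_mul1 : left_id (fpsC 1) fps_mul.
Proof.
move=> f; apply: fpsP => n /=.
rewrite big_ord_recl /= mul1r subn0 big1 ?addr0 // => i _.
by rewrite mul0r.
Qed.

Lemma fps_mulDl : left_distributive fps_mul fps_add.
Proof.
move=> f g h; apply: fpsP => n /=; rewrite -big_split.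
by apply: eq_bigr => i _; rewrite mulrDl.
Qed.

Lemma fps_1_neq0 : fpsC 1 != 0 :> fps R.
Proof.
apply/eqP => /(congr1 (fun f : fps R => fps_coef f 0)) /= /eqP.
by rewrite oner_eq0.
Qed.

HB.instance Definition _ := GRing.Zmodule_isComNzRing.Build (fps R)
  fps_mulA fps_mulC fps_mul1 fps_mulDl fps_1_neq0.

Definition fps_unit : pred (fps R) := fun f => fps_coef f 0 \is a GRing.unit.

(* The list of the first n coefficients of 1 / f, from the recurrence          *)
(* f_0 g_n + f_1 g_(n-1) + ... + f_n g_0 = [n = 0].                            *)
Fixpoint fps_inv_seq f n : seq R :=
  if n is m.+1 then
    let s := fps_inv_seq f m in
    rcons s ((fps_coef f 0)^-1 *
             ((m == 0%N)%:R - \sum_(i < m) fps_coef f (m - i)%N * s`_i))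
  else [::].

Definition fps_inv f : fps R :=
  if fps_unit f then Fps (fun n => (fps_inv_seq f n.+1)`_n) else f.

Lemma size_fps_inv_seq f n : size (fps_inv_seq f n) = n.
Proof. by elim: n => //= n IHn; rewrite size_rcons IHn. Qed.

Lemma nth_fps_inv_seq f n i : (i < n)%N ->
  (fps_inv_seq f n)`_i = (fps_inv_seq f i.+1)`_i.
Proof.
elim: n => // n IHn; rewrite ltnS leq_eqVlt => /orP[/eqP-> //|ltin].
by rewrite [LHS]/= nth_rcons size_fps_inv_seq ltin IHn.
Qed.

Lemma fps_mulV : {in fps_unit, left_inverse 1 fps_inv *%R}.
Proof.
move=> f Uf; apply: fpsP => n.
rewrite /fps_inv [fps_unit f]Uf /= big_ord_recr /= subnn nth_rcons size_fps_inv_seq.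
rewrite ltnn eqxx mulrC mulrA divrr // mul1r addrC.
under [X in _ - X]eq_bigr => i _ do rewrite (@nth_fps_inv_seq f n i) // mulrC.
by rewrite subrK; case: n.
Qed.

Lemma fps_unitPl f g : g * f = 1 -> fps_unit f.
Proof.
move=> /(congr1 (fun u : fps R => fps_coef u 0)) /=.
rewrite big_ord1 => gf1; apply/unitrP; exists (fps_coef g 0).
by rewrite gf1 mulrC gf1.
Qed.

Lemma fps_inv_out : {in [predC fps_unit], fps_inv =1 id}.
Proof. by move=> f /negPf Uf; rewrite /fps_inv [fps_unit f]Uf. Qed.

HB.instance Definition _ := GRing.ComNzRing_hasMulInverse.Build (fps R)
  fps_mulV fps_unitPl fps_inv_out.

Definition fpsZ : fps R := Fps (fun n => (n == 1%N)%:R).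

Definition zadic_lim (u : nat -> fps R) f :=
  forall n, exists K, forall k, (K <= k)%N -> fps_coef (u k) n = fps_coef f n.

Lemma zadic_lim_unique (u : nat -> fps R) f g :
  zadic_lim u f -> zadic_lim u g -> f = g.
Proof.
move=> uf ug; apply: fpsP => n; have [K fK] := uf n; have [L gL] := ug n.
by rewrite -(fK (maxn K L)) ?leq_maxl // gL // leq_maxr.
Qed.

(* The finite continued fraction                                               *)
(*   1/(1 - a_j z - b_(j+1) z^2/(1 - a_(j+1) z - ... - b_(j+k) z^2/            *)
(*                                                    (1 - a_(j+k) z)))        *)
(* with k + 1 levels, starting at index j.                                     *)
Fixpoint jfrac_tail (a b : nat -> R) (k j : nat) : fps R :=
  if k is k'.+1 then
    (1 - fpsC (a j) * fpsZ
       - fpsC (b j.+1) * fpsZ ^+ 2 * jfrac_tail a b k' j.+1)^-1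
  else (1 - fpsC (a j) * fpsZ)^-1.

Definition jfrac_trunc (a b : nat -> R) (k : nat) : fps R := jfrac_tail a b k 0.

(* f is the value of the infinite continued fraction with coefficients a_n     *)
(* (n >= 0) and b_n (n >= 1); the value b_0 is not used.                       *)
Definition is_jfrac (a b : nat -> R) f := zadic_lim (jfrac_trunc a b) f.

End FpsRing.

Arguments fpsZ {R}.

(* The ordinal i : 'I_n stands for the index i + 1 of [n].                     *)
Section Statistics.
Variable n : nat.
Implicit Types s : 'S_n.

Definition is_descent s (i : 'I_n) :=
  [exists j : 'I_n, (j == i.+1 :> nat) && (s j < s i)%N].
Definition is_record s (i : 'I_n) :=
  [forall j : 'I_n, (j < i)%N ==> (s j < s i)%N].
Definition des2 s := #|[set i | is_descent s i && is_record s i]|.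
Definition cyc s := #|porbits s|.

End Statistics.

(* Main.v *)
(* An index i is a record with a type 2 descent iff it is an excedance record  *)
(* and i + 1 is not, so des_2 counts the maximal runs of excedance records.    *)
(* Let m decrease from n to 0 and contract every path of the permutation that  *)
(* lives on the elements >= m to a single node.  Removing the element m from   *)
(* the contracted permutation only sees the number h of nodes and whether m    *)
(* is an excedance record; each time an arrow into m is chosen, exactly one of *)
(* the h + 1 choices closes a cycle.  This gives a two-state walk on h,        *)
(* [walk].  In terms of generating functions in z, its h-th states are a       *)
(* binomial transform in h, with parameter q = (1 - y) z, of the Motzkin path  *)
(* counts attached to the continued fraction; [arr] interpolates between both. *)
Require Import Defs.
From mathcomp Require Import all_boot all_algebra all_fingroup.
From mathcomp Require Import mpoly.
From mathcomp Require Import ring zify.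
Import GRing.Theory.
Local Open Scope ring_scope.

Set Implicit Arguments.
Unset Strict Implicit.
Unset Printing Implicit Defensive.

(** Both sides are computed by recursions on the length. Truncations of the continued fraction count
    Motzkin paths in a strip, so their coefficients stabilise at [motzkin] ([is_jfrac_motzkin]). For
    permutations, [des2_runs] turns type 2 descents into ends of runs of excedance records, and
    removing the top element of a contracted permutation changes cycles and runs in a controlled way
    ([csumS], [half_csumE]); this gives [walk] ([csum_walk]).

    The two recursions differ, since [walk] carries a flag. They meet in the array [arr]: its row
    [h = 0] obeys the Motzkin recurrence, while its columns [j = 0] and [j = 1] hold the two states
    of [walk] ([walk_arr]). The row-column relation [arr_shift] makes these descriptions
    compatible. *)

Fixpoint motzkin (R : comUnitRingType) (a b : nat -> R) (m j : nat) : R :=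
  if m is m'.+1 then
    motzkin a b m' j.+1 + a j * motzkin a b m' j +
    (if j is j'.+1 then b j * motzkin a b m' j' else 0)
  else (j == 0%N)%:R.

(** * Continued fractions and Motzkin paths *)

Section JFraction.
Variables (R : comUnitRingType) (a b : nat -> R).

Lemma coef_fpsZM (f : fps R) n :
  fps_coef (fpsZ * f) n = if n is n'.+1 then fps_coef f n' else 0.
Proof.
case: n => [|n]; first by rewrite /= big_ord1 mul0r.
rewrite /= !big_ord_recl /= mul0r add0r mul1r big1 ?addr0 ?subn1 // => i _.
by rewrite mul0r.
Qed.

Lemma coef_fpsCM c (f : fps R) n : fps_coef (fpsC c * f) n = c * fps_coef f n.
Proof.
rewrite /= big_ord_recl /= subn0 big1 ?addr0 // => i _.
by rewrite mul0r.
Qed.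

Lemma coef0_1BfpsZM (f : fps R) : fps_coef (1 - fpsZ * f) 0 = 1.
Proof. by rewrite -[LHS]/(1 - fps_coef (fpsZ * f) 0) coef_fpsZM subr0. Qed.

Lemma fpsZM_unit (f : fps R) : 1 - fpsZ * f \is a GRing.unit.
Proof.
change (fps_coef (1 - fpsZ * f) 0 \is a GRing.unit).
by rewrite coef0_1BfpsZM unitr1.
Qed.

Definition jfrac_den k j : fps R :=
  if k is k'.+1 then
    1 - fpsZ * (fpsC (a j) + fpsC (b j.+1) * fpsZ * jfrac_tail a b k' j.+1)
  else 1 - fpsZ * fpsC (a j).

Lemma jfrac_den_unit k j : jfrac_den k j \is a GRing.unit.
Proof. by case: k => [|k]; apply: fpsZM_unit. Qed.

Lemma jfrac_tailE k j : jfrac_tail a b k j = (jfrac_den k j)^-1.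
Proof. by case: k => [|k] /=; congr (_^-1); ring. Qed.

(* The generating function of the Motzkin paths from height [j] to [0] in the
   strip of height [k], factored by last passages. *)
Fixpoint jfrac_conv k j : fps R :=
  if j is j'.+1 then
    fpsZ * (fpsC (b j) * jfrac_tail a b (k - j) j * jfrac_conv k j')
  else jfrac_tail a b k 0.

(** Multiplying by the denominator at level [j] cancels one tail; expanding that denominator gives
    the first-step decomposition of a path. *)
Lemma jfrac_conv_rec k j : (j < k)%N ->
  jfrac_conv k j = (j == 0%N)%:R + fpsZ * (jfrac_conv k j.+1 +
    fpsC (a j) * jfrac_conv k j +
    (if j is j'.+1 then fpsC (b j) * jfrac_conv k j' else 0)).
Proof.
move=> ltjk.
have ek : (k - j)%N = (k - j.+1).+1 by lia.
have cden : jfrac_den (k - j) j * jfrac_conv k j =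
    (j == 0%N)%:R + fpsZ * (if j is j'.+1 then fpsC (b j) * jfrac_conv k j' else 0).
  have U := jfrac_den_unit (k - j) j.
  case: j ltjk ek U => [|j] _ _ U.
    rewrite [jfrac_conv k 0]/= jfrac_tailE subn0 in U *.
    by rewrite divrr // mulr0 addr0.
  rewrite [jfrac_conv k j.+1]/= jfrac_tailE add0r; set x := jfrac_den _ _ in U *.
  rewrite [RHS](_ : _ = (x / x) * (fpsZ * (fpsC (b j.+1) * jfrac_conv k j))).
    by ring.
  by rewrite divrr // mul1r.
rewrite mulrDr [X in _ + X]addrC.
rewrite addrA -cden.
rewrite ek [jfrac_conv k j.+1]/= /jfrac_den; ring.
Qed.

(** A path of length [m] from height [j] stays below [m + j], so the strip of height [k] does not
    constrain it. *)
Lemma coef_jfrac_conv k m j : (m + j <= k)%N ->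
  fps_coef (jfrac_conv k j) m = motzkin a b m j.
Proof.
elim: m j => [|m IHm] j lek.
  case: j lek => [|j] _; last by rewrite [jfrac_conv _ _]/= coef_fpsZM.
  have := jfrac_den_unit k 0; rewrite /= jfrac_tailE => /divrr.
  move=> /(congr1 (fun f : fps R => fps_coef f 0)).
  rewrite /= big_ord1.
  suff -> : fps_coef (jfrac_den k 0) 0 = 1 by rewrite mul1r.
  by rewrite /jfrac_den; case: (k) => [|?]; rewrite coef0_1BfpsZM.
have coefD (f g : fps R) n : fps_coef (f + g) n = fps_coef f n + fps_coef g n by [].
rewrite jfrac_conv_rec; last by lia.
rewrite coefD coef_fpsZM 2!coefD coef_fpsCM [motzkin _ _ _ _]/= !IHm; try lia.
have -> : fps_coef ((j == 0%N)%:R : fps R) m.+1 = 0 by case: (j).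
rewrite add0r; congr (_ + _).
by case: j lek => [|j] lek //; rewrite coef_fpsCM IHm //; lia.
Qed.

Lemma is_jfrac_motzkin : is_jfrac a b (Fps (fun n => motzkin a b n 0)).
Proof.
move=> n; exists n => k lenk /=.
by rewrite -(@coef_jfrac_conv k) // addn0.
Qed.

End JFraction.

(** * From the two-state walk to Motzkin paths *)

Section Walks.
Variables (R : comUnitRingType) (y lam : R).

Let a n := lam + 2 * n%:R.
Let b n := (lam + n%:R - 1) * (y + n%:R - 1).

(* [h] is the number of contracted nodes, [c] tells whether [m] (the element
   removed last) is an excedance record. *)
Fixpoint walk (m h : nat) (c : bool) : R :=
  if m is m'.+1 then
    let u g d := walk m' g.+1 d + (lam + g%:R) * walk m' g d in
    u h false +
    (if h is h'.+1 then h'%:R * u h' false + y ^+ (~~ c) * u h' true else 0)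
  else (h == 0%N)%:R.

(* With [D f h = f h.+1 - q * (f h.+1 + f h)] and [w h] the generating function of
   [walk m h true / (lam (lam + 1) ... (lam + h - 1))], the generating function of
   [arr m h j] is [D^j w h], up to the factor [lam (lam + 1) ... (lam + h + j - 1)]. *)
Definition arr_step (f : nat -> nat -> R) (h j : nat) : R :=
  match h with
  | 0 => f 0 j.+1 + a j * f 0 j + (if j is j'.+1 then b j * f 0 j' else 0)
  | h'.+1 =>
      (lam + (h + j)%:R) * f h' j.+1 + f h j.+1 +
      j.+1%:R * (f h j + (lam + (h' + j)%:R) * f h' j) +
      (if h' is h''.+1 then
         h'%:R * (f h' j.+1 + (lam + (h' + j)%:R) * f h'' j.+1)
       else 0)
  end.

Fixpoint arr (m : nat) : nat -> nat -> R :=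
  if m is m'.+1 then arr_step (arr m')
  else fun h j => ((h == 0%N) && (j == 0%N))%:R.

Lemma arr_motzkin m j : arr m 0 j = motzkin a b m j.
Proof.
elim: m j => [|m IHm] j //=; rewrite !IHm; case: j => [|j] //.
by rewrite IHm.
Qed.

(** The defect of the new relation is a linear combination of the defects of the two hypotheses. The
    case [h = 0] is where the values of [a] and [b] enter. *)
Lemma arr_step_shift (p f : nat -> nat -> R) :
    (forall h j, f h j = arr_step p h j) ->
    (forall h j, f h.+1 j =
       f h j.+1 + (1 - y) * (p h.+1 j + (lam + (h + j)%:R) * p h j)) ->
  forall h j, arr_step f h.+1 j =
    arr_step f h j.+1 + (1 - y) * (f h.+1 j + (lam + (h + j)%:R) * f h j).
Proof.
move=> /(_ _ _)/eqP fE /(_ _ _)/eqP f_shift.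
have E h j : f h j - arr_step p h j = 0 by apply/eqP; rewrite subr_eq0.
have D h j : f h.+1 j -
    (f h j.+1 + (1 - y) * (p h.+1 j + (lam + (h + j)%:R) * p h j)) = 0.
  by apply/eqP; rewrite subr_eq0.
case=> [|h] j; apply/eqP; rewrite -subr_eq0; apply/eqP.
  transitivity
    ((f 1 j.+1 - (f 0 j.+2 + (1 - y) * (p 1 j.+1 + (lam + (0 + j.+1)%:R) * p 0 j.+1)))
     + j.+1%:R * (f 1 j - (f 0 j.+1 + (1 - y) * (p 1 j + (lam + (0 + j)%:R) * p 0 j)))
     - (1 - y) * (f 1 j - arr_step p 1 j)).
    by rewrite /arr_step /a /b /=; ring.
  by rewrite !D E; ring.
pose c : R := lam + (h.+1 + j)%:R.
pose d g i := f g.+1 i - (f g i.+1 + (1 - y) * (p g.+1 i + (lam + (g + i)%:R) * p g i)).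
have d0 g i : d g i = 0 by exact: D.
case: h @c => [|h] c.
  transitivity ((c + 1) * d 0 j.+1 + d 1 j.+1 + j.+1%:R * (d 1 j + c * d 0 j)
    - (1 - y) * (f 2 j - arr_step p 2 j + c * (f 1 j - arr_step p 1 j))).
    by rewrite /c /d /arr_step /=; ring.
  by rewrite !d0 !E; ring.
transitivity ((c + 1) * d h.+1 j.+1 + d h.+2 j.+1 + j.+1%:R * (d h.+2 j + c * d h.+1 j)
    + h.+1%:R * (d h.+1 j.+1 + c * d h j.+1)
  - (1 - y) * (f h.+3 j - arr_step p h.+3 j + c * (f h.+2 j - arr_step p h.+2 j))).
  by rewrite /c /d /arr_step /=; ring.
by rewrite !d0 !E; ring.
Qed.

(** Coefficient form of the definition of [D]: multiplication by [q = (1 - y) z] lowers the index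
    [m] by one. *)
Lemma arr_shift m h j :
  arr m.+1 h.+1 j = arr m.+1 h j.+1 +
    (1 - y) * (arr m h.+1 j + (lam + (h + j)%:R) * arr m h j).
Proof.
elim: m h j => [|m IHm] h j; last exact: arr_step_shift.
by case: h => [|[|[|h]]]; case: j => [|j]; rewrite /= /b ?andbF /=; ring.
Qed.

(** The state [true] unfolds into [arr_step]; the state [false] differs from it by [1 - y] times the
    last summand, which is the correction in [arr_shift]. *)
Lemma walk_arr m :
  [/\ forall c, walk m 0 c = arr m 0 0, forall h, walk m h true = arr m h 0 &
      forall h, walk m h.+1 false = arr m h 1].
Proof.
elim: m => [|m [IH0 IHt IHf]]; first by split=> [c|h|h] //=; rewrite ?andbT ?andbF.
have W0 c : walk m.+1 0 c = arr m.+1 0 0 by rewrite /= IHf IH0 /a; ring.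
have Wt h : walk m.+1 h true = arr m.+1 h 0.
  case: h => [|h] //; case: h => [|h] /=; rewrite ?IHt ?IHf ?IH0; ring.
split=> // h; transitivity (walk m.+1 h.+1 true -
    (1 - y) * (arr m h.+1 0 + (lam + (h + 0)%:R) * arr m h 0)).
  by rewrite /= !IHt; ring.
by rewrite Wt arr_shift; ring.
Qed.

Lemma walk_motzkin m c : walk m 0 c = motzkin a b m 0.
Proof. by have [-> _ _] := walk_arr m; rewrite arr_motzkin. Qed.

End Walks.

(** * Runs of a boolean sequence *)

Section Runs.
Implicit Types (r : nat -> bool) (b : bool).

(* Maximal runs of [true] that end before [m]; [b] stands for the value at [m]. *)
Fixpoint runs r m b : nat :=
  if m is m'.+1 then ((r m' && ~~ b) + runs r m' (r m'))%N else 0.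

Lemma eq_runs r r' m b :
  (forall k, (k < m)%N -> r k = r' k) -> runs r m b = runs r' m b.
Proof.
elim: m b => //= m IHm b rr'; rewrite rr' // IHm // => k ltkm.
by rewrite rr' // ltnW.
Qed.

Lemma runs_sum r m : runs r m (r m) = (\sum_(i < m) (r i && ~~ r i.+1))%N.
Proof. by elim: m => [|m IHm]; rewrite ?big_ord0 // big_ord_recr /= -IHm addnC. Qed.

End Runs.

(** * Type 2 descents as ends of runs of excedance records *)

Section RecordExcedances.
Variable n : nat.
Implicit Types (s t : 'S_n) (i j x q : 'I_n) (k : nat).

(** Indexed by [nat] and false from [n] on, so that a run reaching the last index also ends. *)
Definition recexc s k : bool :=
  [exists i : 'I_n, [&& i == k :> nat, (i < s i)%N & is_record s i]].

Lemma recexcE s i : recexc s i = (i < s i)%N && is_record s i.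
Proof.
apply/existsP/andP => [[j /and3P[/eqP/val_inj-> ? ?]] //|[? ?]].
by exists i; apply/and3P.
Qed.

Lemma eq_recexc s t k :
  (forall j, (j <= k)%N -> s j = t j) -> recexc s k = recexc t k.
Proof.
move=> st; apply: eq_existsb => i; case: eqP => //= ik.
rewrite -{k}ik in st; rewrite /is_record (st i (leqnn i)); congr (_ && _).
apply: eq_forallb => j; case: (ltnP j i) => //= /ltnW/st -> //.
Qed.

Lemma descent_record_recexc s i :
  is_descent s i && is_record s i = recexc s i && ~~ recexc s i.+1.
Proof.
rewrite recexcE; case rec_i: (is_record s i); rewrite ?andbF //= !andbT.
have {rec_i} rec_i j : (j < i)%N -> (s j < s i)%N.
  by move/forallP: rec_i => /(_ j)/implyP.
apply/existsP/andP => [[j /andP[/eqP ji desc]] | [exc nrec]].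
  split; last first.
    rewrite -ji recexcE negb_and; apply/orP; right; apply/forallPn; exists i.
    by rewrite negb_imply ji ltnSn -leqNgt ltnW.
  rewrite ltnNge; apply/negP => le_si.
  (* A non-excedance record [i] makes [s] permute [{0, ..., i}], so the next
     value cannot be smaller. *)
  pose A := [set x : 'I_n | (x <= i)%N].
  have sA : s @: A = A.
    apply/eqP; rewrite eqEcard card_imset ?leqnn; last exact: perm_inj.
    rewrite andbT; apply/subsetP => _ /imsetP[x + ->]; rewrite !inE.
    rewrite leq_eqVlt => /orP[/eqP/val_inj-> //|/rec_i lt_s].
    exact: leq_trans (ltnW lt_s) le_si.
  have: s j \in s @: A by rewrite sA inE (leq_trans (ltnW desc)).
  by rewrite mem_imset ?inE ?ji ?ltnn //; exact: perm_inj.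
have lt_i1 : (i.+1 < n)%N by apply: leq_ltn_trans exc (ltn_ord _).
exists (Ordinal lt_i1); rewrite eqxx /=.
(* If the next value were larger, it would be a record, and an excedance because [i < s i]. *)
case: (ltngtP (s (Ordinal lt_i1)) (s i)) => // [lt_s|eq_s]; last first.
  by move/val_inj/perm_inj/(congr1 val)/eqP: eq_s; rewrite /= eqn_leq ltnn.
case/negP: nrec; rewrite -[i.+1]/(val (Ordinal lt_i1)) recexcE /=.
rewrite (leq_ltn_trans exc lt_s); apply/forallP => j; apply/implyP.
rewrite ltnS leq_eqVlt => /orP[/eqP/val_inj-> //|/rec_i lt_j].
exact: ltn_trans lt_j lt_s.
Qed.

Lemma des2_runs s : des2 s = runs (recexc s) n false.
Proof.
have -> : false = recexc s n.
  by apply/esym/existsP => -[i /andP[/eqP e]]; move: (ltn_ord i); rewrite e ltnn.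
rewrite runs_sum /des2 -sum1_card big_mkcond /=.
by apply: eq_bigr => i _; rewrite inE descent_record_recexc; case: (_ && _).
Qed.

(** The transposition merges the fixed point [q] into the cycle of [i]. *)
Lemma cyc_del s i q : i != q -> s q = q -> cyc s = (cyc (tperm i q * s)%g).+1.
Proof.
move=> neq_iq fix_q; have := porbits_mul_tperm s i q; rewrite /= neq_iq /cyc.
suff -> : i \notin porbit s q by move=> /= /eqP; rewrite addn2 addn1 eqSS => /eqP <-.
apply/porbitP => -[k ik]; case/eqP: neq_iq; rewrite ik.
by elim: k {ik} => [|k IHk]; rewrite ?perm1 // expgSr permM IHk.
Qed.

End RecordExcedances.

(** * Removing elements from contracted permutations *)

Section Contraction.
Variables (R : idomainType) (y lam : R).
Hypothesis lam_neq0 : lam != 0.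
Variable n : nat.
Implicit Types (s : 'S_n) (i p q x : 'I_n) (B : {set 'I_n}).

(* Each node in [B] is named after the first element of the path that it stands for. *)
Definition contracted m B s : bool :=
  perm_on ([set x : 'I_n | (x < m)%N] :|: B) s && [forall (x | x \in B), (s x < m)%N].

Lemma contractedP m B s :
  reflect ((forall x, (m <= x)%N -> x \notin B -> s x = x) /\
           (forall x, x \in B -> (s x < m)%N))
          (contracted m B s).
Proof.
apply: (iffP andP) => -[on_s lt_s]; split.
- move=> x lemx nBx; apply/eqP; apply: contraR nBx => /(subsetP on_s).
  by rewrite !inE ltnNge lemx.
- by move=> x Bx; apply: (implyP (forallP lt_s x)).
- apply/subsetP => x; rewrite !inE; apply: contraR; rewrite negb_or -leqNgt.
  by case/andP=> ? ?; rewrite on_s.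
- by apply/forall_inP.
Qed.

Definition weight m b s : R := lam ^+ cyc s * y ^+ runs (recexc s) m b.

Definition csum m B b : R := \sum_(s | contracted m B s) weight m b s.

(** Halfway through the removal of [i]: its outgoing arrow is settled, the arrow into it is not. *)
Definition half_csum i B b : R :=
  \sum_(s | contracted i.+1 B s && (s i < i.+1)%N) weight i b s.

Lemma weight_del (m : nat) p q b s :
    (m <= p)%N -> (m <= q)%N -> p != q -> s q = q ->
  lam * weight m b (tperm p q * s)%g = weight m b s.
Proof.
move=> lemp lemq neq_pq sq; rewrite /weight mulrA -exprS -cyc_del //.
congr (_ * _ ^+ _); apply: eq_runs => k ltkm; apply: eq_recexc => j lejk.
by rewrite permM tpermD //; apply/eqP => /(congr1 val) /=; lia.
Qed.

(** Split on the arrow into [i]. If it does not come from [i |: B], then [i] becomes a new node. If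
    it comes from [i] itself, a cycle closes. If it comes from [p] in [B], sending [p] directly to
    [s i] makes [i] a fixed point, which is the extra factor [lam]. *)
Lemma half_csumE i B b : (forall x, x \in B -> (i < x)%N) ->
  lam * half_csum i B b = lam * csum i (i |: B) b + (lam + #|B|%:R) * csum i B b.
Proof.
move=> ltB.
have niB : i \notin B by apply/negP => /ltB; rewrite ltnn.
pose P s := contracted i.+1 B s && (s i < i.+1)%N.
rewrite /half_csum (bigID (fun s => [forall (x | x \in i |: B), (s x < i)%N])) /=.
rewrite mulrDr; congr (_ * _ + _).
  apply: eq_bigl => s; apply/andP/contractedP.
    move=> [/andP[/contractedP[fx lt1] lti] /forall_inP lt].
    split=> // x lex; rewrite !inE negb_or => /andP[neq_xi nBx].
    by apply: fx; rewrite // ltn_neqAle eq_sym lex neq_xi.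
  move=> [fx lt].
  split; last by apply/forall_inP.
  apply/andP; split; last by rewrite ltnS ltnW // lt // setU11.
  apply/contractedP; split=> x => [ltix nBx|Bx].
    apply: fx; first exact: ltnW.
    rewrite !inE negb_or nBx andbT.
    by apply: contraTneq ltix => ->; rewrite ltnn.
  by rewrite ltnS ltnW // lt // setU1r.
rewrite (partition_big (fun s => s^-1 i)%g (mem (i |: B))) /=; last first.
  move=> s /andP[/andP[/contractedP[fx lt1] lti] /forall_inPn[x Bx]].
  rewrite -leqNgt => le_i; suff /(congr1 (s^-1)%g) <- : s x = i by rewrite permK.
  apply/val_inj/eqP; rewrite eqn_leq le_i andbT -ltnS.
  by move: Bx; rewrite !inE => /orP[/eqP->|/lt1].
have part p : p \in i |: B ->
    \sum_(s | P s && ~~ [forall (x | x \in i |: B), (s x < i)%N] && ((s^-1)%g i == p))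
      weight i b s = \sum_(s | contracted i B s) weight i b (tperm i p * s)%g.
  move=> Bp; rewrite (reindex_inj (mulgI (tperm i p))) /=.
  apply: eq_bigl => s.
  apply/andP/contractedP => [[/andP[/andP[/contractedP[fx lt1] lti] _] /eqP ip]|[fx lt1]].
    have si : s i = i by move: (permKV (tperm i p * s)%g i); rewrite ip permM tpermR.
    have lt2 x : x \in i |: B -> (s (tperm i p x) < i.+1)%N.
      by rewrite !inE -permM => /orP[/eqP->|/lt1].
    have lt3 x : x \in B -> (s x < i)%N.
      move=> Bx; rewrite ltn_neqAle -ltnS; apply/andP; split.
        apply/eqP => /val_inj; rewrite -{1}si => /perm_inj xi.
        by rewrite -xi Bx in niB.
      have neq_xi : i != x by apply: contraNneq niB => ->.
      case: (eqVneq p x) => [<-|neq_px].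
        by rewrite -(tpermL i p) lt2 // setU11.
      by rewrite -(tpermD neq_xi neq_px) lt2 // setU1r.
    split=> // x lex nBx; case: (eqVneq i x) => [<- //|neq_ix].
    rewrite -{2}(fx x) //; last by rewrite ltn_neqAle neq_ix.
    rewrite permM tpermD //; apply: contraTneq Bp => ->.
    by rewrite !inE negb_or eq_sym neq_ix.
  have si : s i = i by apply: fx.
  have lt2 x : x \in i |: B -> (s (tperm i p x) < i.+1)%N.
    move=> Bx; have : tperm i p x \in i |: B.
      by case: tpermP => [||]; rewrite ?setU11.
    by rewrite !inE => /orP[/eqP->|/lt1/ltnW //]; rewrite si.
  have sp : (tperm i p * s)%g p = i by rewrite permM tpermR.
  split; last by apply/eqP/(@perm_inj _ (tperm i p * s)%g); rewrite permKV sp.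
  apply/andP; split; last first.
    by apply/forall_inPn; exists p; rewrite // sp ltnn.
  apply/andP; split; last by rewrite permM lt2 ?setU11.
  apply/contractedP; split=> x => [ltix nBx|Bx]; rewrite permM; last first.
    by rewrite lt2 // setU1r.
  have neq_ix : i != x by apply: contraTneq ltix => ->; rewrite ltnn.
  rewrite tpermD //; first by rewrite fx // ltnW.
  by apply: contraTneq Bp => ->; rewrite !inE negb_or eq_sym neq_ix.
rewrite (eq_bigr _ part) big_setU1 //= mulrDr mulrDl; congr (_ + _).
  by congr (_ * _); apply: eq_bigr => s _; rewrite tperm1 mul1g.
rewrite mulr_sumr (eq_bigr (fun=> csum i B b)) ?sumr_const ?mulr_natl // => p Bp.
rewrite mulr_sumr; apply: eq_bigr => s /contractedP[fx lt1].
have neq_ip : i != p by apply: contraNneq niB => ->.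
by rewrite tpermC weight_del ?fx // 1?eq_sym // ltnW // ltB.
Qed.

(** Split on the arrow out of [i]: either [i] is not an excedance, or [s i] is a node [q], which is
    merged with [i] and left as a fixed point. The values above [i] taken on indices up to [i] are
    exactly the elements of [B], so in the second case [i] is a record iff [q] is the largest
    node. *)
Lemma csumS i B b : (forall x, x \in B -> (i < x)%N) ->
  lam * csum i.+1 B b = lam * half_csum i B false +
    \sum_(q in B) (if [forall (x | x \in B), (x <= q)%N]
                   then y ^+ (~~ b) * half_csum i (B :\ q) true
                   else half_csum i (B :\ q) false).
Proof.
move=> ltB.
have niB : i \notin B by apply/negP => /ltB; rewrite ltnn.
have weightS s : weight i.+1 b s =
    y ^+ (recexc s i && ~~ b) * weight i (recexc s i) s.
  by rewrite /weight /= exprD mulrCA.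
rewrite /csum (bigID (fun s => (s i < i.+1)%N)) /= mulrDr; congr (_ * _ + _).
  apply: eq_bigr => s /andP[_ lti]; rewrite weightS.
  suff -> : recexc s i = false by rewrite mul1r.
  by rewrite recexcE ltnNge -ltnS lti.
rewrite (partition_big (fun s => s i) (mem B)) /=; last first.
  move=> s /andP[/contractedP[fx _] gti].
  apply: contraNT gti => nB; apply/negPn; case: ltnP => // gti.
  have /perm_inj e : s (s i) = s i by apply: fx.
  by rewrite e ltnn in gti.
rewrite mulr_sumr; apply: eq_bigr => q Bq.
have neq_iq : i != q by apply: contraNneq niB => ->.
have ltiq := ltB q Bq.
rewrite (reindex_inj (mulgI (tperm i q))) /=.
pose Q s := [&& contracted i.+1 B (tperm i q * s)%g, ~~ ((tperm i q * s)%g i < i.+1)%N &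
               (tperm i q * s)%g i == q].
under eq_bigl => s do rewrite -andbA -/(Q s).
have QE s : Q s = contracted i.+1 (B :\ q) s && (s i < i.+1)%N.
  rewrite /Q !permM tpermL.
  apply/and3P/andP => [[/contractedP[fx lt1] gti /eqP sq]|[/contractedP[fx lt1] lti]].
    split; last by have := lt1 q Bq; rewrite permM tpermR.
    apply/contractedP; split=> x.
      move=> ltix; rewrite !inE negb_and negbK => /orP[/eqP->|nBx] //.
      rewrite -{2}(fx x) // permM tpermD //; first by apply: contraTneq ltix => ->; rewrite ltnn.
      by apply: contraNneq nBx => <-.
    rewrite !inE => /andP[neq_xq Bx]; have := lt1 x Bx.
    by rewrite permM tpermD 1?eq_sym //; apply: contraNneq niB => <-.
  have sq : s q = q by apply: fx; rewrite // !inE eqxx.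
  rewrite sq eqxx -leqNgt; split=> //.
  apply/contractedP; split=> x => [ltix nBx|Bx]; rewrite permM.
    rewrite tpermD ?fx // ?inE ?negb_and ?nBx ?orbT //.
      by apply: contraTneq ltix => ->; rewrite ltnn.
    by apply: contraNneq nBx => <-.
  case: tpermP => [xi|//|/eqP neq_xi /eqP neq_xq].
    by rewrite xi (negPf niB) in Bx.
  by rewrite lt1 // !inE neq_xq.
have fE s : Q s -> lam * weight i.+1 b (tperm i q * s)%g =
    y ^+ ([forall (x | x \in B), (x <= q)%N] && ~~ b) *
    weight i [forall (x | x \in B), (x <= q)%N] s.
  move=> Qs; rewrite weightS mulrCA weight_del //; last first.
  - by move: Qs; rewrite QE => /andP[/contractedP[fx _] _]; apply: fx; rewrite // !inE eqxx.
  - exact: ltnW.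
  suff -> : recexc (tperm i q * s)%g i = [forall (x | x \in B), (x <= q)%N] by [].
  move: Qs; rewrite /Q; set t := (_ * s)%g => /and3P[/contractedP[fx lt1] _ /eqP ti].
  rewrite recexcE ti ltiq /= /is_record.
  apply/forallP/forall_inP => [rec x Bx|maxq x].
    rewrite leqNgt; apply/negP => ltqx.
    have tx : t (t^-1 x)%g = x by rewrite permKV.
    have neq : (t^-1 x)%g != i.
      apply/eqP => e; have := congr1 t e; rewrite tx ti => xq.
      by rewrite xq ltnn in ltqx.
    case: (ltnP (t^-1 x)%g i) => [lt|ge].
      by have := implyP (rec _) lt; rewrite tx ti ltnNge ltnW.
    have gt : (i < (t^-1 x)%g)%N by rewrite ltn_neqAle eq_sym neq.
    case: (boolP ((t^-1 x)%g \in B)) => [/lt1|/(fx _ gt)]; rewrite tx.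
      by rewrite ltnS leqNgt ltB.
    by move=> xe; have := lt1 x Bx; rewrite -xe in tx; rewrite tx ltnS leqNgt ltB.
  apply/implyP => ltxi; rewrite ti.
  have neq_tx : t x != q by rewrite -ti; apply: contraTneq ltxi => /perm_inj->; rewrite ltnn.
  case: (boolP (t x \in B)) => [/maxq le_q|nB].
    by rewrite ltn_neqAle le_q andbT; apply: contraNneq neq_tx => /val_inj->.
  apply: leq_ltn_trans ltiq; case: (leqP (t x) i) => // gti.
  have /perm_inj e := fx _ gti nB.
  by rewrite e ltnNge ltnW // in gti.
rewrite mulr_sumr (eq_bigr _ fE) (eq_bigl _ _ QE) -mulr_sumr.
by case: [forall (x | x \in B), (x <= q)%N]; rewrite //= mul1r.
Qed.

(* The elements [>= m] outside [B] are fixed points of [s], so they add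
   [n - m - #|B|] to [cyc s]; this is what the powers of [lam] compensate. *)
Lemma csum_walk m B b : (m <= n)%N -> (forall x, x \in B -> (m <= x)%N) ->
  lam ^+ (m + #|B|) * csum m B b = lam ^+ n * walk y lam m #|B| b.
Proof.
elim: m B b => [|m IHm] B b lemn leB.
  rewrite /csum /=; case: (set_0Vmem B) => [->|[x Bx]].
    rewrite cards0 mul1r mulr1 (big_pred1 1%g) => [|s].
      rewrite /weight mulr1 /cyc; congr (lam ^+ _).
      rewrite card_imset ?card_ord //.
      move=> x z exz; have := porbit_id 1%g x; rewrite exz => /porbitP[k ->].
      by rewrite expg1n perm1.
    apply/contractedP/eqP => [[fx _]|->]; first by apply/permP => x; rewrite fx ?perm1 ?inE.
    by split=> x; rewrite ?perm1 ?inE.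
  rewrite (gtn_eqF (_ : 0 < #|B|)%N); last by apply/card_gt0P; exists x.
  rewrite mulr0 big_pred0 ?mulr0 // => s; apply/negP => /contractedP[_ /(_ x Bx)].
  by rewrite ltn0.
pose i := Ordinal lemn.
have half (C : {set 'I_n}) (c : bool) : (forall x, x \in C -> (i < x)%N) ->
    lam ^+ (m.+1 + #|C|) * half_csum i C c =
    lam ^+ n * (walk y lam m #|C|.+1 c + (lam + #|C|%:R) * walk y lam m #|C| c).
  move=> ltC; have niC : i \notin C by apply/negP => /ltC; rewrite ltnn.
  have E1 := IHm C c (ltnW lemn) (fun x Cx => ltnW (ltC x Cx)).
  have E2 : lam ^+ (m + #|C|.+1) * csum m (i |: C) c = lam ^+ n * walk y lam m #|C|.+1 c.
    have := IHm (i |: C) c (ltnW lemn); rewrite cardsU1 niC; apply=> x.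
    by rewrite !inE => /orP[/eqP->|/ltC/ltnW].
  rewrite addSn exprSr -mulrA half_csumE //.
  transitivity (lam ^+ (m + #|C|) * lam * csum m (i |: C) c +
                (lam + #|C|%:R) * (lam ^+ (m + #|C|) * csum m C c)); first by ring.
  by rewrite E1 -exprSr -addnS E2; ring.
apply: (mulfI lam_neq0); rewrite mulrCA (@csumS i) // mulrDr mulrCA half //.
rewrite [walk _ _ _ #|B| b]/= !mulrDr; congr (_ + _).
case: (set_0Vmem B) => [->|[x0 Bx0]]; first by rewrite cards0 big_set0 !mulr0.
have [q Bq maxq] : exists2 q, q \in B & forall x, x \in B -> (x <= q)%N.
  by case: (arg_maxnP (fun x : 'I_n => x : nat) Bx0) => q; exists q.
have cardD1 x : x \in B -> #|B| = #|B :\ x|.+1 by move=> Bx; rewrite (cardsD1 x) Bx.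
have ltD1 x z : z \in B :\ x -> (i < z)%N by move=> /setD1P[_ /leB].
case def_h: #|B| => [|h]; first by rewrite (cardD1 q) in def_h.
have halfD1 x c : x \in B -> lam ^+ (m.+1 + h.+1) * half_csum i (B :\ x) c =
    lam * (lam ^+ n * (walk y lam m h.+1 c + (lam + h%:R) * walk y lam m h c)).
  move=> Bx; have := half (B :\ x) c (@ltD1 x).
  have -> : #|B :\ x| = h by apply/eqP; rewrite -eqSS -cardD1 // def_h.
  by move=> <-; rewrite mulrA -exprS addnS.
(* The largest node [q] gives the term with state [true]; the other [h] nodes give equal terms with
   state [false]. *)
rewrite (bigD1 q) //= ifT; last by apply/forall_inP.
set u := fun c => walk y lam m h.+1 c + (lam + h%:R) * walk y lam m h c.
rewrite mulrDr mulrCA halfD1 // addrC mulr_sumr.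
rewrite (eq_bigr (fun=> lam * (lam ^+ n * u false))) => [|x /andP[Bx neq_xq]].
  rewrite sumr_const (_ : #|_| = h); first by rewrite -mulr_natr /u; ring.
  apply/eqP; rewrite -eqSS -def_h (cardD1 q) // eqSS; apply/eqP.
  by apply: eq_card => x; rewrite !inE andbC.
rewrite ifF ?halfD1 //; apply/negP => /forall_inP/(_ q Bq) le_qx.
by case/eqP: neq_xq; apply/val_inj/eqP; rewrite eqn_leq le_qx maxq.
Qed.

End Contraction.

(** At [m = n] with no nodes every permutation is contracted, and the factors [lam ^+ n] cancel. *)
Lemma sum_des2_cyc (R : idomainType) (y lam : R) n : lam != 0 ->
  \sum_(s : 'S_n) y ^+ des2 s * lam ^+ cyc s = walk y lam n 0 false.
Proof.
move=> lam_neq0; apply: (mulfI (expf_neq0 n lam_neq0)).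
have <- : lam ^+ (n + #|@set0 'I_n|) * csum y lam n (@set0 'I_n) false =
          lam ^+ n * walk y lam n 0 false.
  by rewrite csum_walk ?cards0 // => x; rewrite inE.
rewrite cards0 addn0; congr (_ * _); rewrite /csum; apply: eq_big => [s|s _].
  by apply/esym/contractedP; split=> x; rewrite ?inE // leqNgt ltn_ord.
by rewrite /weight des2_runs mulrC.
Qed.

Theorem mainTheorem1 :
  let y : {mpoly int[2]} := 'X_0 in
  let lam : {mpoly int[2]} := 'X_1 in
  is_jfrac
    (fun n => lam + 2 * n%:R)
    (fun n => (lam + n%:R - 1) * (y + n%:R - 1))
    (Fps (fun n => \sum_(s : 'S_n) y ^+ des2 s * lam ^+ cyc s)).
Proof.
move=> y lam.
have lam_neq0 : lam != 0.
  by apply/eqP => /(congr1 (fun p => p@_U_(1)%MM)); rewrite mcoeffX eqxx mcoeff0.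
have -> : Fps (fun n => \sum_(s : 'S_n) y ^+ des2 s * lam ^+ cyc s) =
    Fps (fun n => motzkin (fun n => lam + 2 * n%:R)
                          (fun n => (lam + n%:R - 1) * (y + n%:R - 1)) n 0).
  by apply: fpsP => n; rewrite /= sum_des2_cyc // walk_motzkin.
exact: is_jfrac_motzkin.
Qed.
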